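(* Let $X$ be a nonempty set and $\tau$ a nonempty family of subsets of $X$ such that $(X,\tau)$ is $T_1$. Then the following are equivalent: $(X,\tau)$ is $[\omega,\omega]$-compact; $(X,\tau)$ is $[\alpha,\alpha]$-compact for some countably infinite ordinal $\alpha$; $(X,\tau)$ is $[\alpha,\alpha]$-compact for every countably infinite ordinal $\alpha$; $(X,\tau)$ is $[\omega,\omega_1)$-compact.
   Context: For a nonempty set $X$, a nonempty family $\tau$ of subsets of $X$ (not necessarily a topology) and nonzero ordinals $\alpha,\beta$, $(X,\tau)$ is $[\beta,\alpha]$-compact if, whenever $(O_\delta)_{\delta\in\alpha}$ is a sequence of members of $\tau$ (repetitions allowed) with $\bigcup_{\delta\in\alpha}O_\delta=X$, there is $H\subseteq\alpha$ of order type $<\beta$ (in the induced order) with $\bigcup_{\delta\in H}O_\delta=X$. $(X,\tau)$ is $[\beta,\alpha)$-compact if it is $[\beta,\alpha']$-compact for every nonzero $\alpha'<\alpha$. $(X,\tau)$ is $T_1$ if for every $O\in\tau$ and every $x\in O$, $O\setminus\{x\}\in\tau$ (for a topology $\tau$ this is the usual $T_1$ axiom). *)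

(* Defs.v *)
From HB Require Import structures.
From mathcomp Require Import all_boot.
From mathcomp Require Import all_classical wochoice.

Set Implicit Arguments.
Unset Strict Implicit.
Unset Printing Implicit Defensive.

Local Open Scope classical_set_scope.
Local Open Scope card_scope.

(* An ordinal is represented by a well-ordered type.  Every notion below is
   invariant under order isomorphism, so that quantifying over well-ordered
   types amounts to quantifying over ordinals.  [wochoice.well_order], where
   every nonempty subset has a unique minimum, already entails that the
   relation is a total order. *)
Record Ord := MkOrd {
  ord_carrier :> Type;
  ord_le : rel ord_carrier;
  ord_wo : well_order ord_le }.

Arguments ord_le {o} x y.

Definition ord_slt (a : Ord) (x y : a) : Prop := ord_le x y /\ x <> y.

Lemma ord_sub_wo (a : Ord) (H : set a) :
  well_order (fun x y : set_type H => ord_le (val x) (val y)).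
Proof.
move=> A [x Ax].
pose B : {pred a} := fun y => `[< exists2 z : set_type H, z \in A & val z = y >].
have neB : nonempty B by exists (val x); apply/asboolP; exists x.
have [m [[/asboolP[z Az zm] mB] um]] := ord_wo neB.
exists z; split.
  split=> // y Ay; rewrite zm; apply: mB; apply/asboolP; by exists y.
move=> y [Ay ymin]; apply: val_inj; rewrite zm; apply: um; split.
  by apply/asboolP; exists y.
by move=> _ /asboolP[w Aw <-]; exact: ymin.
Qed.

(* The subset H of a with the induced order. *)
Definition ord_sub (a : Ord) (H : set a) : Ord := MkOrd (@ord_sub_wo a H).

Definition ord_iso (a b : Ord) : Prop :=
  exists f : a -> b, bijective f /\ {mono f : x y / ord_le x y}.

Definition ord_lt (a b : Ord) : Prop :=
  exists y : b, ord_iso a (ord_sub [set x : b | ord_slt x y]).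

Definition ord_nonzero (a : Ord) : Prop := [set: a] !=set0.

Definition countably_infinite (a : Ord) : Prop := [set: a] #= [set: nat].

Lemma leq_wo : well_order leq.
Proof.
apply: antisymmetric_well_order; first exact: anti_leq.
move=> A neA; exists (ex_minn neA); case: ex_minnP => m Am mA.
by split=> // n An; exact: mA.
Qed.

Definition omega : Ord := MkOrd leq_wo.

Definition wo_set_nat : Ord := MkOrd (svalP (well_ordering_principle (set nat))).

(* The first uncountable ordinal, obtained from a well-order of the continuum
   by keeping the points that have only countably many predecessors. *)
Definition omega1 : Ord :=
  ord_sub [set x : wo_set_nat | countable [set y : wo_set_nat | ord_slt y x]].

(* The next two facts say that omega1 is the first uncountable ordinal: every
   smaller ordinal is countable, and omega1 itself is not. *)
Lemma ord_lt_omega1_countable (a : Ord) : ord_lt a omega1 -> countable [set: a].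
Proof.
move=> [y [f [/bij_inj finj _]]].
have /countable_injP[g ginj] := set_mem (valP y).
have below (x : a) : (val (val (f x)) : wo_set_nat) \in
    [set z : wo_set_nat | ord_slt z (val y)].
  apply/mem_set; have [le_xy ne_xy] := set_mem (valP (f x)).
  by split=> // /val_inj.
apply/countable_injP; exists (fun x => g (val (val (f x)))) => x1 x2 _ _ e.
by apply: finj; do 2 apply: val_inj; apply: ginj.
Qed.

Lemma omega1_uncountable : ~ countable [set: omega1].
Proof.
set S := [set x : wo_set_nat | countable [set y : wo_set_nat | ord_slt y x]].
move=> /countable_injP[g ginj].
have cS : countable S.
  apply/countable_injP.
  exists (fun x => if pselect (x \in S) is left Sx
                   then g (exist _ x Sx : omega1) else 0).
  move=> x1 x2 Sx1 Sx2.
  case: pselect => [p1|/(_ Sx1)[]]; case: pselect => [p2|/(_ Sx2)[]] e0.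
  exact: (congr1 val (ginj _ _ (in_setT _) (in_setT _) e0)).
have [all_S | /existsNP[x0 nSx0]] := pselect (forall x, S x).
  have /countable_injP[f finj] := cS.
  pose D : set nat := [set n | exists x : wo_set_nat, f x = n /\ ~ (x : set nat) n].
  have [D_ | nD] := pselect (D (f D)); last by case: (nD); exists D; split.
  have [x [fx nx]] := D_; apply: nx.
  by have -> : x = D by apply: finj => //; apply/mem_set/all_S.
have [] := @ord_wo wo_set_nat (fun x => `[< ~ S x >]).
  by exists x0; apply/asboolP.
move=> m [[/asboolP nSm minm] um]; apply: nSm.
apply: sub_countable cS; apply: subset_card_le => y [le_ym ne_ym].
apply: contrapT => nSy; apply: ne_ym; apply/esym/um; split; first exact/asboolP.
move=> z zA; have le_mz := minm z zA.
have le_my : ord_le m y by apply: minm; apply/asboolP.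
have wo_le : wo_chain (@ord_le wo_set_nat : rel (set nat)) predT.
  by apply: withinW; exact: (@ord_wo wo_set_nat).
have -> // : y = m.
by apply: (wo_chain_antisymmetric wo_le) => //; rewrite le_ym.
Qed.

Definition is_T1 (X : Type) (tau : set (set X)) : Prop :=
  forall O, tau O -> forall x, O x -> tau (O `\ x).

(* [beta, alpha]-compactness *)
Definition cc_compact (X : Type) (tau : set (set X)) (beta alpha : Ord) : Prop :=
  forall O : alpha -> set X, (forall d, tau (O d)) ->
    \bigcup_(d in [set: alpha]) O d = [set: X] ->
  exists H : set alpha,
    ord_lt (ord_sub H) beta /\ \bigcup_(d in H) O d = [set: X].

(* [beta, alpha)-compactness *)
Definition co_compact (X : Type) (tau : set (set X)) (beta alpha : Ord) : Prop :=
  forall alpha' : Ord, ord_nonzero alpha' -> ord_lt alpha' alpha ->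
    cc_compact tau beta alpha'.

(* Main.v *)
Require Import Defs.
From mathcomp Require Import all_boot.
From mathcomp Require Import all_classical.

(** Over the natural numbers an order type below [omega] means a finite set, so
    [[omega, omega]]-compactness says that every countable cover by members of
    [tau] has a finite subcover ([countable_cover_compact]).  This formulation
    ignores the order of the indices.  It therefore passes to covers indexed by
    an arbitrary nonempty countable ordinal [alpha]
    ([finite_subcover_countable]), and a finite set of indices has order type
    below [omega], and below [alpha] when [alpha] is infinite
    ([finite_lt_infinite]).  Hence it implies the other three conditions.

    The reverse implication from [[omega, omega1)]-compactness needs only one
    infinite ordinal below [omega1] ([omega1_infinite_segment]): a countable
    cover can be reindexed by it.

    The implication that needs the T1 axiom starts from a single infinite
    countable [alpha] with [[alpha, alpha]]-compactness.  If some countable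
    cover had no finite subcover, it could be turned into an infinite
    countable cover in which each member owns a point lying in no other member
    ([minimal_infinite_cover]).  Reindexed along a bijection with [alpha], that
    cover has no subcover but itself, so the index set of the subcover is the
    whole of [alpha], whose order type is not below [alpha]
    ([ord_sub_setT_irrefl]). *)

Local Open Scope classical_set_scope.
Local Open Scope card_scope.

(** * Well-orders with a finite or an infinite number of points *)

Lemma card_eqTP (T U : Type) :
  [set: T] #= [set: U] <-> exists f : T -> U, bijective f.
Proof.
split=> [/card_bijP[f [g fK gK]]|[f [g fK gK]]].
  exists (fun x => val (f (SigSub (in_setT x)))).
  exists (fun y => val (g (SigSub (in_setT y)))) => [x|y].
    suff -> : SigSub (in_setT (val (f (SigSub (in_setT x)))))
            = f (SigSub (in_setT x)) by rewrite fK.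
    exact: val_inj.
  suff -> : SigSub (in_setT (val (g (SigSub (in_setT y)))))
            = g (SigSub (in_setT y)) by rewrite gK.
  exact: val_inj.
apply/card_bijP; exists (fun x => SigSub (in_setT (f (val x)))).
by exists (fun y => SigSub (in_setT (g (val y)))) => x;
  apply: val_inj; rewrite /= ?fK ?gK.
Qed.

Lemma ord_min {a : Ord} (A : set a) : A !=set0 ->
  exists2 m, A m & forall y, A y -> ord_le m y.
Proof.
move=> [x Ax]; have [|m [[/asboolP Am mA] _]] := @ord_wo a (fun y => `[< A y >]).
  by exists x; apply/asboolP.
by exists m => // y Ay; apply: mA; apply/asboolP.
Qed.

Lemma ord_le_total (a : Ord) : total (@ord_le a).
Proof.
move=> x y; have [|m] := @ord_min a [set x; y]; first by exists x; left.
by move=> [->|->] le_m; apply/orP; [left|right]; apply: le_m; [right|left].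
Qed.

Lemma ord_le_refl (a : Ord) : reflexive (@ord_le a).
Proof. by move=> x; have /orP[] := ord_le_total a x x. Qed.

Lemma ord_le_anti (a : Ord) (x y : a) : ord_le x y -> ord_le y x -> x = y.
Proof.
move=> xy yx; have [|m [_ um]] := @ord_wo a (fun z => `[< z = x \/ z = y >]).
  by exists x; apply/asboolP; left.
rewrite -(um x) ?(um y) //; split; try by apply/asboolP; auto.
  by move=> _ /asboolP[] ->; rewrite ?ord_le_refl.
by move=> _ /asboolP[] ->; rewrite ?ord_le_refl.
Qed.

Lemma ord_le_trans (a : Ord) : transitive (@ord_le a).
Proof.
move=> y x z xy yz; have [|m] := @ord_min a [set t | [\/ t = x, t = y | t = z]].
  by exists x; constructor 1.
move=> mE le_m; have [mx my mz] : [/\ ord_le m x, ord_le m y & ord_le m z].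
  by split; apply: le_m; [constructor 1|constructor 2|constructor 3].
case: mE => mE; subst m => //; first by rewrite (ord_le_anti _ _ _ xy mx).
by rewrite (ord_le_anti _ _ _ yz my) in xy.
Qed.

Lemma ord_ltNge (a : Ord) (x y : a) : ~~ ord_le y x <-> ord_slt x y.
Proof.
split=> [nyx|[xy ne]]; last by apply/negP => yx; apply/ne/ord_le_anti.
have /orP[xy|yx] := ord_le_total a x y; last by rewrite yx in nyx.
by split=> // e; rewrite e ord_le_refl in nyx.
Qed.

Lemma ord_slt_le_trans (a : Ord) (y x z : a) :
  ord_slt x y -> ord_le y z -> ord_slt x z.
Proof.
move=> [xy ne] yz; split; first exact: ord_le_trans xy yz.
by move=> e; subst z; apply/ne/ord_le_anti.
Qed.

Lemma ord_le_slt_trans (a : Ord) (y x z : a) :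
  ord_le x y -> ord_slt y z -> ord_slt x z.
Proof.
move=> xy [yz ne]; split; first exact: ord_le_trans xy yz.
by move=> e; subst z; apply/ne/ord_le_anti.
Qed.

(** The isomorphism is the rank, the number of points strictly below.  The
    count is done in ['I_n], through any bijection of the carrier with it,
    in order to use cardinals of finite types. *)
Lemma finite_ord_iso (a : Ord) (n : nat) : [set: a] #= `I_n ->
  exists f : a -> 'I_n, bijective f /\ {mono f : x y / ord_le x y >-> x <= y}.
Proof.
move=> an; have /card_eqTP[f [g fK gK]] := card_eq_trans an card_II.
pose below x := [set i : 'I_n | ~~ ord_le x (g i)]%SET.
have rank_lt x : #|below x| < n.
  rewrite -[X in _ < X]card_ord -cardsT; apply: proper_card.
  rewrite properE finset.subsetT; apply/fintype.subsetPn; exists (f x) => //.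
  by rewrite inE fK ord_le_refl.
have rank_mono x y : (#|below x| <= #|below y|) = ord_le x y.
  have sub u v : ord_le u v -> below u \subset below v.
    move=> uv; apply/fintype.subsetP => i; rewrite !inE; apply: contra.
    exact: ord_le_trans uv.
  apply/idP/idP => [|/sub/subset_leq_card//].
  apply: contraLR => nxy; rewrite -ltnNge; apply: proper_card.
  have [yx _] := (ord_ltNge a y x).1 nxy.
  rewrite properE sub //=; apply/fintype.subsetPn; exists (f y).
    by rewrite inE fK.
  by rewrite inE fK ord_le_refl.
pose r x := Ordinal (rank_lt x).
have rinj : injective r.
  move=> x y [] /eqP; rewrite eqn_leq !rank_mono => /andP[].
  exact: ord_le_anti.
exists r; split=> //.
have [] := @inj_card_bij _ _ (r \o g) _ (leqnn _).
  by apply: inj_comp => //; exact: can_inj gK.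
move=> h hK Kh; exists (g \o h) => x /=; last exact: Kh.
by rewrite -[in LHS](fK x) hK fK.
Qed.

(** By induction on [n]: a point [y] with [n] points below it is not the last
    one, since only [n.+1] points are at most [y]; the least point above [y]
    then has exactly these [n.+1] points below it. *)
Lemma infinite_ord_segment (b : Ord) (n : nat) : infinite_set [set: b] ->
  exists y : b, [set x | ord_slt x y] #= `I_n.
Proof.
move=> infb; elim: n => [|n [y yn]].
  have [m _ mle] := ord_min _ (infinite_setN0 infb).
  exists m; rewrite II0 card_eq0; apply/eqP; rewrite -subset0 => x.
  by move=> /ord_ltNge/negP; apply; exact: mle.
have segS : [set x | ord_le x y] #= `I_n.+1.
  apply/eq_cardSP; exists y; first exact: ord_le_refl.
  by apply: card_eq_trans yn; rewrite (_ : _ `\ _ = [set x | ord_slt x y]).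
have [|z /= /negP/ord_ltNge yz zmin] := @ord_min b (~` [set x | ord_le x y]).
  apply: infinite_setN0; rewrite -setTD; apply: infinite_setD => //.
  by apply/finite_setP; exists n.+1.
exists z; suff -> : [set x | ord_slt x z] = [set x | ord_le x y] by [].
apply/seteqP; split=> x /= => [|xy]; last exact: ord_le_slt_trans xy yz.
by move=> /ord_ltNge; apply: contraNP; exact: zmin.
Qed.

(** The infinite order has an initial segment of the same finite size, and two
    finite well-orders of the same size are isomorphic, both being isomorphic
    to the same ['I_n]. *)
Lemma finite_lt_infinite (a b : Ord) :
  finite_set [set: a] -> infinite_set [set: b] -> ord_lt a b.
Proof.
move=> /finite_setP[n an] infb; have [y yn] := infinite_ord_segment _ n infb.
exists y; have [f [fbij fmono]] := finite_ord_iso _ _ an.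
have [|g [gbij gmono]] := finite_ord_iso (ord_sub [set x | ord_slt x y]) n.
  exact: card_eq_trans (card_setT _) yn.
have [h gK hK] := gbij.
exists (h \o f); split; first by apply: bij_comp => //; exists g.
by move=> u v; rewrite -[LHS]gmono /= !hK fmono.
Qed.

Lemma lt_omega_finite (a : Ord) : ord_lt a omega -> finite_set [set: a].
Proof.
move=> [n [f [fbij _]]].
have e : [set: a] #= [set: ord_sub [set x : omega | ord_slt x n]].
  by apply/card_eqTP; exists f.
rewrite (eq_finite_set e) (eq_finite_set (card_setT _)).
apply: (sub_finite_set _ (finite_II n)) => x [/= xn ne].
by rewrite ltn_neqAle xn andbT; apply/eqP.
Qed.

Lemma lt_omegaP (a : Ord) (H : set a) :
  ord_lt (ord_sub H) omega <-> finite_set H.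
Proof.
rewrite -(eq_finite_set (card_setT _)); split; first exact: lt_omega_finite.
by move=> Hfin; apply: finite_lt_infinite => //; exact: infinite_nat.
Qed.

(** A self-embedding [F] of a well-order cannot lower any point: if [m] is the
    least point with [F m < m], then applying [F] gives [F (F m) < F m], so
    [F m] is a smaller such point.  A map onto the segment below [y] would
    lower [y]. *)
Lemma ord_sub_setT_irrefl (a : Ord) : ~ ord_lt (ord_sub [set: a]) a.
Proof.
move=> [y [f [_ fmono]]].
pose F x : a := val (f (SigSub (in_setT x))).
have Fmono : {mono F : u v / ord_le u v}.
  by move=> u v; have := fmono (SigSub (in_setT u)) (SigSub (in_setT v)).
have Flt x : ord_slt (F x) y by exact: set_mem (valP (f _)).
have [|m /ord_ltNge mF mmin] := @ord_min a [set x | ord_slt (F x) x].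
  by exists y; exact: Flt.
have : ord_slt (F (F m)) (F m) by apply/ord_ltNge; rewrite Fmono.
by move=> /mmin; apply/negP.
Qed.

(** Choose [u n] with exactly [n] points below it.  The segments below the
    [u n] are countable, so some [y] is outside all of them; [y] then lies above
    segments of every finite size. *)
Lemma omega1_infinite_segment :
  exists y : omega1, infinite_set [set x | ord_slt x y].
Proof.
have /choice[u uE] : forall n, exists y : omega1,
    [set x | ord_slt x y] #= `I_n.
  move=> n; apply: infinite_ord_segment => /finite_set_countable.
  exact: omega1_uncountable.
have cseg (z : omega1) : countable [set x | ord_slt x z].
  rewrite -(eq_countable (card_setT _)).
  apply: (@ord_lt_omega1_countable (ord_sub [set x | ord_slt x z])).
  by exists z, idfun; split=> //; exists idfun.
have /existsNP[y yout] :
    ~ forall y, (\bigcup_(n in [set: nat]) [set x | ord_slt x (u n)]) y.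
  move=> all_in; apply: omega1_uncountable.
  apply: sub_countable
    (bigcup_countable (countableP [set: nat]) (fun n _ => cseg (u n))).
  by apply: subset_card_le => x _; exact: all_in.
have uy n : ord_le (u n) y.
  by apply: contrapT => /negP/ord_ltNge yu; apply: yout; exists n.
exists y => /finite_setP[m ym].
suff : `I_m.+1 #<= `I_m by rewrite card_le_II ltnn.
rewrite -(card_le_eqr ym) -(card_le_eql (uE m.+1)); apply: subset_card_le => x.
by move=> /ord_slt_le_trans; apply; exact: uy.
Qed.

(** * Finite subcovers of countable covers *)

Definition countable_cover_compact {X : Type} (tau : set (set X)) : Prop :=
  forall O : nat -> set X, (forall n, tau (O n)) ->
    \bigcup_(n in [set: nat]) O n = [set: X] ->
  exists2 D : set nat, finite_set D & \bigcup_(n in D) O n = [set: X].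

(** A surjection of the natural numbers onto the index set turns the cover into
    a sequence; the image of a finite set of integers is finite. *)
Lemma finite_subcover_countable (X : Type) (tau : set (set X))
    (a : Ord) (O : a -> set X) :
  countable_cover_compact tau -> ord_nonzero a -> countable [set: a] ->
  (forall d, tau (O d)) -> \bigcup_(d in [set: a]) O d = [set: X] ->
  exists2 H : set a, finite_set H & \bigcup_(d in H) O d = [set: X].
Proof.
move=> cc [d0 _] /countable_injP[f finj] tauO covO.
have [g gf] : exists g : nat -> a, cancel f g.
  have ginv n : exists d, forall e, f e = n -> d = e.
    have [[e fe]|nof] := pselect (exists e, f e = n).
      by exists e => e' fe'; apply: finj; rewrite ?inE // fe'.
    by exists d0 => e fe; case: nof; exists e.
  by have [g gE] := choice ginv; exists g => d; exact: gE.
have [|D Dfin covD] := cc (O \o g) (fun n => tauO (g n)).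
  rewrite -covO; apply/seteqP; split=> x [i _ Oi]; first by exists (g i).
  by exists (f i) => //=; rewrite gf.
exists (g @` D); first exact: finite_image.
rewrite -covD; apply/seteqP; split=> x [i].
  by move=> [n Dn <-] Ox; exists n.
by move=> Di Ox; exists (g i) => //; exists i.
Qed.

Lemma countable_cover_compact_of_omega (X : Type) (tau : set (set X))
    (a : Ord) :
  countably_infinite a -> cc_compact tau omega a -> countable_cover_compact tau.
Proof.
move=> /card_eqTP[f [g fK gK]] ca O tauO covO.
have [|H [Hfin covH]] := ca (O \o f) (fun d => tauO (f d)).
  rewrite -covO; apply/seteqP; split=> x [i _ Oi]; first by exists (f i).
  by exists (g i) => //=; rewrite gK.
exists (f @` H); first by apply: finite_image; exact/lt_omegaP.
rewrite -covH; apply/seteqP; split=> x [i].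
  by move=> [n Dn <-] Ox; exists n.
by move=> Di Ox; exists (f i) => //; exists i.
Qed.

Lemma cc_compact_omega (X : Type) (tau : set (set X)) :
  cc_compact tau omega omega <-> countable_cover_compact tau.
Proof.
split; first exact: (countable_cover_compact_of_omega _ _ omega (card_eqxx _)).
move=> cc O tauO covO; have [D Dfin covD] := cc O tauO covO.
by exists D; split=> //; apply/lt_omegaP.
Qed.

(** * The T1 axiom and minimal covers *)

Lemma T1_setD_finite (X : Type) (tau : set (set X)) (U F : set X) :
  is_T1 tau -> finite_set F -> tau U -> tau (U `\` F).
Proof.
move=> T1 /finite_setP[n]; elim: n F => [|n IHn] F.
  by rewrite II0 card_eq0 => /eqP->; rewrite setD0.
move=> /eq_cardSP[x Fx Fn] tauU.
have -> : U `\` F = (U `\` (F `\ x)) `\ x.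
  rewrite setDDl; congr (_ `\` _); apply/seteqP.
  split=> y; last by move=> [[]|->].
  by move=> Fy; have [->|ne] := pselect (y = x); [right|left].
have tauD := IHn _ Fn tauU.
(* The axiom only removes points that belong to the set. *)
have [Dx|nDx] := pselect ((U `\` (F `\ x)) x); first exact: T1.
suff -> : (U `\` (F `\ x)) `\ x = U `\` (F `\ x) by [].
by apply/seteqP; split=> [y []//|y Dy]; split=> // e; rewrite e in Dy.
Qed.

(** Let [nu x] be the first index of a member of the cover that contains [x].
    The members whose index is in the range [N] of [nu] still cover, so [N] is
    infinite when there is no finite subcover.  For [n] in [N] pick [p n] with
    [nu (p n) = n]: no earlier member contains it, and it has to be taken out of
    the later ones.  Each member thereby loses only finitely many points, which
    the T1 axiom permits, and each removed point [p n] stays in the member of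
    index [n]. *)
Lemma minimal_infinite_cover (X : Type) (tau : set (set X)) :
  is_T1 tau -> ~ countable_cover_compact tau ->
  exists (V : nat -> set X) (p : nat -> X),
  [/\ forall n, tau (V n), \bigcup_(n in [set: nat]) V n = [set: X]
    & forall n m, V m (p n) -> m = n].
Proof.
move=> T1 /existsNP[O] /not_implyP[tauO] /not_implyP[covO] nofin.
have {}nofin D : finite_set D -> \bigcup_(n in D) O n <> [set: X].
  by move=> Dfin covD; apply: nofin; exists D.
have /choice[nu nuE] : forall x, exists n, O n x /\ forall i, O i x -> n <= i.
  move=> x; have [n _ Onx] : (\bigcup_(n in [set: nat]) O n) x by rewrite covO.
  have ex : exists n, `[< O n x >] by exists n; apply/asboolP.
  exists (ex_minn ex); case: ex_minnP => m /asboolP Om mmin; split=> // i Oi.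
  by apply: mmin; apply/asboolP.
pose N := range nu.
have Ninf : infinite_set N.
  move=> /nofin; apply; apply/seteqP; split=> // x _.
  by exists (nu x); [exists x|have [] := nuE x].
have /choice[p pE] : forall n, exists x, N n -> nu x = n.
  move=> n; have [[x _ nx]|nN] := pselect (N n); first by exists x.
  have [_ [x _ _]] := infinite_setN0 Ninf.
  by exists x => /nN.
pose V n := O n `\` p @` (`I_n `&` N).
have tauV n : tau (V n).
  apply: T1_setD_finite => //; apply: finite_image.
  exact: (sub_finite_set (@subIsetl _ _ _) (finite_II n)).
have covV : \bigcup_(n in N) V n = [set: X].
  apply/seteqP; split=> // x _.
  have [[i Ni <-]|nop] := pselect ((p @` N) x).
    exists i => //; split; first by have [] := nuE (p i); rewrite pE.
    move=> [j [/= ji Nj] pij]; have := congr1 nu pij.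
    by rewrite !pE // => ij; rewrite ij ltnn in ji.
  exists (nu x); first by exists x.
  split; first by have [] := nuE x.
  by move=> [j [_ Nj] jx]; apply: nop; exists j.
have Vp n m : N n -> V m (p n) -> m = n.
  move=> Nn [Om nrem]; apply/eqP; rewrite eqn_leq.
  have [_ /(_ m Om)] := nuE (p n); rewrite pE // => -> /=.
  by rewrite andbT leqNgt; apply/negP => nm; apply: nrem; exists n.
(* The cover indexed by N is renumbered by all the natural numbers. *)
have /card_eqTP[e [e' eK e'K]] : [set: nat] #= [set: N].
  rewrite (card_eqr (card_setT N)) card_eqPle; split; first exact/infiniteP.
  exact: countableP.
exists (fun k => V (val (e k))), (fun k => p (val (e k))); split=> //.
  rewrite -covV; apply/seteqP; split=> x [n].
    by move=> _ Vx; exists (val (e n)) => //; exact: set_mem (valP (e n)).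
  by move=> Nn Vx; exists (e' (SigSub (mem_set Nn))) => //; rewrite e'K.
move=> n m /Vp mn; apply: (can_inj eK); apply: val_inj; apply: mn.
exact: set_mem (valP (e n)).
Qed.

(** A minimal infinite cover, reindexed by [a], has no proper subcover. *)
Lemma countable_cover_compact_of_self (X : Type) (tau : set (set X))
    (a : Ord) :
  is_T1 tau -> countably_infinite a -> cc_compact tau a a ->
  countable_cover_compact tau.
Proof.
move=> T1 /card_eqTP[f [g fK gK]] ca; apply: contrapT => /minimal_infinite_cover.
move=> /(_ T1)[V [p [tauV covV Vp]]].
have [|H [Hlt covH]] := ca (V \o f) (fun d => tauV (f d)).
  rewrite -covV; apply/seteqP; split=> x [n _ Vx]; first by exists (f n).
  by exists (g n) => //=; rewrite gK.
apply: (@ord_sub_setT_irrefl a); suff <- : H = [set: a] by [].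
apply/seteqP; split=> // d _.
(* The point owned by the member of index d is covered by that member only. *)
have [c Hc /= /Vp/(can_inj fK) cd] : (\bigcup_(c in H) (V \o f) c) (p (f d)).
  by rewrite covH.
by rewrite -cd.
Qed.

Theorem corollary6p8 (X : Type) (tau : set (set X)) :
  [set: X] !=set0 -> tau !=set0 -> is_T1 tau ->
  [<-> cc_compact tau omega omega;
       exists alpha : Ord, countably_infinite alpha /\ cc_compact tau alpha alpha;
       forall alpha : Ord, countably_infinite alpha -> cc_compact tau alpha alpha;
       co_compact tau omega omega1].
Proof.
move=> _ _ T1; tfae.
- by move=> c; exists omega; split=> //; exact: card_eqxx.
- move=> [a [ainf /(countable_cover_compact_of_self _ _ _ T1 ainf) cc]] b binf.
  have bInf : infinite_set [set: b].
    by rewrite (eq_finite_set binf); exact: infinite_nat.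
  move=> O tauO covO; have bcount : countable [set: b].
    by rewrite (eq_countable binf); exact: countableP.
  have [H Hfin covH] := finite_subcover_countable _ _ _ O cc
    (infinite_setN0 bInf) bcount tauO covO.
  exists H; split=> //; apply: finite_lt_infinite => //.
  by rewrite (eq_finite_set (card_setT _)).
- move=> /(_ omega (card_eqxx _))/cc_compact_omega cc b b0 blt O tauO covO.
  have [H Hfin covH] := finite_subcover_countable _ _ _ O cc b0
    (ord_lt_omega1_countable blt) tauO covO.
  by exists H; split=> //; apply/lt_omegaP.
- have [y yinf] := omega1_infinite_segment.
  have ylt : ord_lt (ord_sub [set x | ord_slt x y]) omega1.
    by exists y, idfun; split=> //; exists idfun.
  have sinf : infinite_set [set: ord_sub [set x | ord_slt x y]].
    by rewrite /= (eq_finite_set (card_setT _)).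
  move=> /(_ _ (infinite_setN0 sinf) ylt) c; apply/cc_compact_omega.
  apply: countable_cover_compact_of_omega c; apply/card_eqPle; split.
    exact: ord_lt_omega1_countable.
  exact/infiniteP.
Qed.
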